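(* If $q=2kn+1$ is a prime power with $k\geq 3$ and $n$ odd, then there exist at least $\lfloor n/k^3\rfloor$ mutually orthogonal $k$-cycle systems of order $q$.
   Context: A $k$-cycle system of order $v$ is a set of $k$-cycles whose edge sets partition the edge set of the complete graph $K_v$. Two $k$-cycle systems of $K_v$ are orthogonal if no $k$-cycle of one system shares more than one edge with a $k$-cycle of the other. A family of cycle systems is mutually orthogonal if any two of them are orthogonal. *)

(* Defs.v *)
From mathcomp Require Import all_boot.

Set Implicit Arguments.
Unset Strict Implicit.
Unset Printing Implicit Defensive.

Definition prime_power (q : nat) : Prop :=
  exists p e : nat, [/\ prime p, 0 < e & q = p ^ e].

(* Edges are 2-element sets of vertices. *)
Definition complete_graph (T : finType) : {set {set T}} :=
  [set e : {set T} | #|e| == 2].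

(* Edge set of the closed walk through the vertices of c; [next] wraps around
   from the last vertex to the first. *)
Definition cycle_edges (T : finType) (c : seq T) : {set {set T}} :=
  [set [set x; next c x] | x in c].

(* A cycle is identified with its edge set, so that rotations and reversals of
   the same vertex sequence give the same cycle. *)
Definition is_kcycle (T : finType) (k : nat) (C : {set {set T}}) : Prop :=
  2 < k /\ exists c : seq T, [/\ uniq c, size c = k & C = cycle_edges c].

Definition kcycle_system (k v : nat) (S : {set {set {set 'I_v}}}) : Prop :=
  (forall C, C \in S -> is_kcycle k C) /\ partition S (complete_graph 'I_v).

Definition orthogonal_systems (v : nat) (S1 S2 : {set {set {set 'I_v}}}) : Prop :=
  forall C1 C2, C1 \in S1 -> C2 \in S2 -> #|C1 :&: C2| <= 1.

Definition mutually_orthogonal (v : nat) (F : {set {set {set {set 'I_v}}}}) : Prop :=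
  forall S1 S2, S1 \in F -> S2 \in F -> S1 <> S2 -> orthogonal_systems S1 S2.

(* Main.v *)
(**
Let [w] generate the multiplicative group of the field with [q] elements.  A
starter is a sequence [d 0, .., d k.-1] of field elements summing to [0], with
distinct partial sums, and with [d i ^ (2n) = w ^ (2ni)], so that the [d i] lie
in the [k] distinct cosets of the [2n]-th roots of unity.  As [n] is odd, every
[2n]-th root of unity is [a] or [-a] for exactly one [n]-th root of unity [a];
hence the images of the cycle of partial sums under the maps [x |-> a x + b]
with [a ^ n = 1] form a [k]-cycle system.  If cycles built from starters [d] and
[d'] share two edges, then [d i / d j] is [d' i / d' j] up to sign for some
[i < j].

Starters avoiding these coincidences are found greedily, up to the last two
entries, which must be a representation of a given nonzero [t] as a sum of
elements of two given cosets.  By a second-moment count of point-line incidences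
in the affine plane, the number [N] of representations satisfies
[(q N - (2n) ^ 2) ^ 2 <= q ^ 3], which for [M.+1 <= n / k ^ 3] exceeds the
number [(4k - 6) M + k - 1] of forbidden choices left by [M] earlier starters.
*)

Require Import Defs.
From mathcomp Require Import all_boot all_order all_algebra cyclic finfield.
From mathcomp Require Import zify ring.

Set Implicit Arguments.
Unset Strict Implicit.
Unset Printing Implicit Defensive.

Import Order.TTheory GRing.Theory Num.Theory.

(** * Second moment of point-line incidences in the affine plane *)

Section Incidence.

Local Open Scope ring_scope.
Variable F : finFieldType.
Implicit Types (p l : F * F) (L : {set F * F}).

(** A line is encoded as a pair (slope, intercept), so only non-vertical lines occur. *)
Definition incident p l := p.2 == l.1 * p.1 + l.2.

Lemma card_points_on_line l : (\sum_p (incident p l : nat) = #|F|)%N.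
Proof.
rewrite -(pair_big xpredT xpredT (fun x y => incident (x, y) l : nat)) /=.
under eq_bigr => x _.
  rewrite (bigD1 (l.1 * x + l.2)) //= /incident eqxx big1 ?addn0; last first.
    by move=> y /negbTE /= ->.
  over.
by rewrite sum_nat_const muln1.
Qed.

Lemma card_common_points l l' : l != l' ->
  (\sum_p (incident p l * incident p l' : nat) <= 1)%N.
Proof.
move=> ll'; under eq_bigr do rewrite mulnb.
rewrite -big_mkcond sum1_card /=.
apply/card_le1_eqP => -[x y] [x' y'].
rewrite !unfold_in /incident /= => /andP[/eqP-> /eqP e] /andP[/eqP-> /eqP e'].
case: (eqVneq l.1 l'.1) => [h1|h1].
  move: e; rewrite h1 => /addrI h2; case/eqP: ll'.
  by rewrite [l]surjective_pairing [l']surjective_pairing h1 h2.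
have xx' : x = x'.
  have : (l.1 - l'.1) * (x - x') = 0.
    by rewrite (_ : _ * _ = (l.1 * x + l.2) - (l'.1 * x + l'.2)
       - ((l.1 * x' + l.2) - (l'.1 * x' + l'.2))); [rewrite e e'; ring | ring].
  by move/eqP; rewrite mulf_eq0 !subr_eq0 (negbTE h1) => /eqP.
by rewrite xx'.
Qed.

Definition degree L p : nat := #|[set l in L | incident p l]|.

Lemma degreeE L p : degree L p = (\sum_(l in L) (incident p l : nat))%N.
Proof.
rewrite /degree -sum1_card big_mkcond [RHS]big_mkcond /=.
by apply: eq_bigr => l _; rewrite !inE; case: (l \in L).
Qed.

Lemma sum_degree L : (\sum_p degree L p = #|F| * #|L|)%N.
Proof.
under eq_bigr do rewrite degreeE.
rewrite exchange_big /=; under eq_bigr do rewrite card_points_on_line.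
by rewrite sum_nat_const mulnC.
Qed.

(** The sum counts pairs of lines with a common point: each line paired with itself gives [#|F|]
    points, two distinct lines at most one. *)
Lemma sum_degree_sqr L :
  (\sum_p degree L p ^ 2 <= #|F| * #|L| + #|L| ^ 2)%N.
Proof.
under eq_bigr do rewrite -mulnn {1}degreeE degreeE big_distrlr /=.
rewrite exchange_big /=; under eq_bigr do rewrite exchange_big /=.
have -> : (#|F| * #|L| + #|L| ^ 2 = \sum_(l in L) (#|F| + #|L|))%N.
  by rewrite sum_nat_const; ring.
apply: leq_sum => l lL; rewrite (bigD1 l) //=; apply: leq_add.
  rewrite -(card_points_on_line l); apply: leq_sum => p _.
  by case: (incident p l).
rewrite -sum1_card [leqRHS](bigD1 l) //=; apply: leq_trans (leq_addl _ _).
by apply: leq_sum => l' /andP[_]; rewrite eq_sym => /card_common_points.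
Qed.

(** The mean degree is [#|L| / #|F|]; deviations are scaled by [#|F|] to stay integral. In the
    expanded square the terms in [#|L| ^ 2] cancel. *)
Lemma degree_variance L :
  \sum_p ((#|F| * degree L p)%:Z - #|L|%:Z) ^+ 2 <= (#|F| ^ 3 * #|L|)%:Z.
Proof.
have -> : \sum_p ((#|F| * degree L p)%:Z - #|L|%:Z) ^+ 2 =
    #|F|%:Z ^+ 2 * (\sum_p degree L p ^ 2)%N%:Z
    - 2%:Z * #|F|%:Z * #|L|%:Z * (\sum_p degree L p)%N%:Z
    + #|F|%:Z ^+ 2 * #|L|%:Z ^+ 2.
  rewrite !(big_morph Posz PoszD (erefl _)) !mulr_sumr -sumrB.
  have -> : #|F|%:Z ^+ 2 * #|L|%:Z ^+ 2 = \sum_(p : F * F) #|L|%:Z ^+ 2.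
    by rewrite sumr_const card_prod -mulr_natl natz PoszM.
  rewrite -big_split /=; apply: eq_bigr => p _; lia.
rewrite sum_degree; have := sum_degree_sqr L; nia.
Qed.

(* The line [(x, y)] in [X * Y] passes through the point [(u, t w)] of
   [H * t H] iff [x u / w + y / w = t]; hence the [#|H| ^ 2] points of
   [H * t H] all have the same degree, the number of representations of [t],
   and share the variance. *)
Lemma card_sum_representations (e h N : nat) (a b t : F) :
  (0 < e)%N -> a != 0 -> b != 0 -> t != 0 ->
  h = #|[set x : F | x ^+ e == 1]| ->
  N = #|[set x : F | (x ^+ e == a ^+ e) && ((t - x) ^+ e == b ^+ e)]| ->
  ((#|F| * N)%:Z - (h ^ 2)%:Z) ^+ 2 <= (#|F| ^ 3)%:Z.
Proof.
move=> e0 a0 b0 t0 hE NE.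
pose H (c : F) := [set x : F | x ^+ e == c ^+ e].
have cardH c : c != 0 -> #|H c| = h.
  move=> c0; rewrite hE -[RHS](card_imset _ (mulfI c0)).
  apply: eq_card => x; apply/idP/imsetP.
    rewrite inE => /eqP xc; exists (x / c); last by rewrite mulrC divfK.
    by rewrite inE exprMn exprVn xc divff ?expf_neq0.
  by case=> y; rewrite !inE => /eqP y1 ->; rewrite exprMn y1 mulr1.
pose L := setX (H a) (H b).
pose P := setX (H 1) (H t).
have h0 : (0 < h)%N by rewrite hE; apply/card_gt0P; exists 1; rewrite inE expr1n.
have cL : #|L| = (h ^ 2)%N by rewrite cardsX !cardH // mulnn.
have cP : #|P| = (h ^ 2)%N by rewrite cardsX !cardH ?oner_eq0 // mulnn.
have Hn0 c x : c != 0 -> x \in H c -> x != 0.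
  rewrite inE => c0; apply: contraL => /eqP->.
  by rewrite expr0n -[e]prednK //= eq_sym expf_neq0.
have degP p : p \in P -> degree L p = N.
  case: p => u v; rewrite inE /= => /andP[Hu Hv].
  have u0 := Hn0 _ _ (oner_neq0 _) Hu; have v0 := Hn0 _ _ t0 Hv.
  move: Hu Hv; rewrite !inE expr1n => /eqP u1 /eqP vt.
  (* Scaling [t = x + (t - x)] by the root of unity [v / t] gives a representation of [v] in the
     same two cosets; [f x] is the line through [(u, v)] that it defines. *)
  pose f x := (x * (v / t) / u, v - x * (v / t)).
  have vt0 : v / t != 0 by rewrite mulf_neq0 // invr_eq0.
  have vt1 : (v / t) ^+ e = 1 by rewrite exprMn exprVn vt divff // expf_neq0.
  have finj : injective f.
    by move=> x y [_] /addrI/oppr_inj/(mulIf vt0).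
  rewrite /degree NE -[RHS](card_imset _ finj).
  apply: eq_card => -[x y]; apply/idP/imsetP.
    rewrite !inE /incident /= => /andP[/andP[/eqP xa /eqP yb] /eqP vE].
    exists (x * u / (v / t)).
      rewrite inE !exprMn exprVn vt1 u1 xa invr1 !mulr1 eqxx /=.
      have -> : t - x * u / (v / t) = y / (v / t).
        have -> : y = v - x * u by rewrite vE; ring.
        by field; rewrite v0 t0.
      by rewrite exprMn exprVn vt1 invr1 mulr1 yb.
    by rewrite /f divfK // mulfK // vE; congr pair; ring.
  case=> w; rewrite !inE /= => /andP[/eqP wa /eqP wb] [-> ->].
  rewrite exprMn exprVn [(w * _) ^+ e]exprMn vt1 u1 wa invr1 !mulr1 eqxx /=.
  have -> : v - w * (v / t) = (t - w) * (v / t) by field; rewrite t0.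
  rewrite exprMn vt1 mulr1 wb eqxx /=.
  by rewrite /incident /=; apply/eqP; field; rewrite u0 t0.
have var := degree_variance L.
rewrite (bigID (mem P)) /= in var.
have : \sum_(p in P) ((#|F| * degree L p)%:Z - #|L|%:Z) ^+ 2 <=
   (#|F| ^ 3 * #|L|)%:Z.
  by apply: le_trans var; rewrite lerDl sumr_ge0 // => p _; rewrite sqr_ge0.
rewrite (eq_bigr (fun=> ((#|F| * N)%:Z - (h ^ 2)%:Z) ^+ 2)); last first.
  by move=> p Pp; rewrite degP // cL.
(* [P] and [L] both have [h ^ 2] elements, so this factor cancels. *)
rewrite sumr_const cP cL -mulr_natl natz [leRHS]PoszM [leRHS]mulrC ler_pM2l //.
by rewrite ltz_nat expn_gt0 h0.
Qed.

End Incidence.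

(** * The numerical inequality behind the last greedy step *)

Lemma last_step_inequality (k n M N q : int) :
  (3 <= k -> 0 <= M -> k ^+ 3 * (M + 1) <= n -> N <= (4 * k - 6) * M + k - 1 ->
  q = 2 * k * n + 1 -> q ^+ 3 < (q * N - (2 * n) ^+ 2) ^+ 2)%R.
Proof.
move=> k3 M0 nM NB qE.
(* [s] is the slack in the bound on [n]. Since [k * (2 * n) ^+ 2 = 2 * n * (q - 1)], [k * G] exceeds
   [q * W] by [q - 2 * n], so it suffices that [W ^+ 2] exceeds [k ^+ 2 * q]. *)
pose K : int := (k ^+ 3)%R; pose s : int := (n - K * (M + 1))%R.
pose G : int := ((2 * n) ^+ 2 - q * N)%R.
pose W : int := (2 * n - k * N - 1)%R.
have s0 : (0 <= s)%R by rewrite subr_ge0.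
have k2K : (3 * k ^+ 2 <= K)%R.
  by rewrite /K (exprS k 2) ler_wpM2r // sqr_ge0.
have k2 : (3 * k <= k ^+ 2)%R by rewrite expr2 ler_wpM2r //; lia.
have K0 : (27 <= K)%R by lia.
have KM0 : (0 <= K * M)%R by apply: mulr_ge0; lia.
have n0 : (27 <= n)%R by rewrite /s in s0; lia.
have kn : (3 * n <= k * n)%R by rewrite ler_wpM2r //; lia.
have q0 : (0 < q)%R by lia.
have W1 : (4 * s + 3 * K + 2 * (K * M) <= 2 * W)%R.
  have kNB : (k * N <= k * ((4 * k - 6) * M + k - 1))%R by rewrite ler_wpM2l //; lia.
  have MK : (0 <= (2 * K - 8 * k ^+ 2 + 12 * k) * M)%R.
    apply: mulr_ge0 => //.
    have -> : (2 * K - 8 * k ^+ 2 + 12 * k = 2 * (k * ((k - 2) ^+ 2 + 2)))%R.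
      by rewrite /K; ring.
    apply: mulr_ge0 => //; apply: mulr_ge0; first lia.
    by rewrite addr_ge0 ?sqr_ge0.
  rewrite /W /s; lia.
have W2 : (4 * (k ^+ 2 * q) < (2 * W) ^+ 2)%R.
  have V0 : (0 <= 4 * s + 3 * K + 2 * (K * M))%R by lia.
  apply: lt_le_trans (_ : _ < (4 * s + 3 * K + 2 * (K * M)) ^+ 2)%R _; last first.
    by rewrite ler_sqr ?nnegrE //; apply: le_trans W1.
  have -> : (4 * (k ^+ 2 * q) =
      8 * (K * s) + 8 * (K * K) + 8 * (K * (K * M)) + 4 * k ^+ 2)%R.
    by rewrite qE /s /K; ring.
  have KK : (27 * K <= K * K)%R by rewrite ler_wpM2r //; lia.
  have Ks : (0 <= K * s)%R by apply: mulr_ge0; lia.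
  have KKM : (0 <= K * (K * M))%R by apply: mulr_ge0; lia.
  have ss : (0 <= (4 * s + 2 * (K * M)) ^+ 2)%R by apply: sqr_ge0.
  have -> : ((4 * s + 3 * K + 2 * (K * M)) ^+ 2 = (4 * s + 2 * (K * M)) ^+ 2
      + 24 * (K * s) + 12 * (K * (K * M)) + 9 * (K * K))%R by ring.
  lia.
have W0 : (0 <= W)%R by lia.
have GW : (q * W <= k * G)%R.
  have -> : (k * G = q * W + (2 * (k * n) + 1 - 2 * n))%R by rewrite /G /W qE; ring.
  lia.
have -> : ((q * N - (2 * n) ^+ 2) ^+ 2 = G ^+ 2)%R by rewrite /G; ring.
have GW2 : ((q * W) ^+ 2 <= (k * G) ^+ 2)%R.
  have qW : (0 <= q * W)%R by apply: mulr_ge0 => //; apply: ltW.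
  by rewrite ler_sqr ?nnegrE //; apply: le_trans GW.
have k20 : (0 < 4 * k ^+ 2)%R by rewrite mulr_gt0 // exprn_gt0 //; lia.
rewrite -(ltr_pM2l k20).
apply: lt_le_trans (_ : _ < (q ^+ 2 * (2 * W) ^+ 2))%R _; last first.
  by rewrite (_ : q ^+ 2 * _ = 4 * (q * W) ^+ 2)%R; [lia | ring].
rewrite (_ : _ * q ^+ 3 = q ^+ 2 * (4 * (k ^+ 2 * q)))%R; last by ring.
by rewrite ltr_pM2l // exprn_gt0.
Qed.

(** * Greedy construction of starters *)

Section Starters.

Local Open Scope ring_scope.
Variables (F : finFieldType) (k n : nat) (w : F).
Hypothesis k_gt2 : (2 < k)%N.
Hypothesis n_gt0 : (0 < n)%N.
Hypothesis cardF : #|F| = (2 * k * n + 1)%N.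
Hypothesis prim_w : (2 * k * n).-primitive_root w.
Implicit Types (d : nat -> F) (D : nat -> nat -> F).

Definition in_class (i : nat) (x : F) := x ^+ (2 * n) == w ^+ (2 * n * i).

Lemma w_neq0 : w != 0.
Proof.
apply/eqP => w0; have := prim_expr_order prim_w.
rewrite w0 expr0n gtn_eqF ?(prim_order_gt0 prim_w) // => /eqP.
by rewrite eq_sym oner_eq0.
Qed.

Lemma in_class_neq0 i x : in_class i x -> x != 0.
Proof.
apply: contraL => /eqP->; rewrite /in_class expr0n muln_eq0 /= -[n]prednK //=.
by rewrite eq_sym expf_neq0 // w_neq0.
Qed.

Lemma card_unity_roots : #|[set x : F | x ^+ (2 * n) == 1]| = (2 * n)%N.
Proof.
have kdvd : (2 * n %| 2 * k * n)%N by apply/dvdnP; exists k; ring.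
have prim_v := dvdn_prim_root prim_w kdvd.
set v := w ^+ _ in prim_v.
have vinj : injective (fun i : 'I_(2 * n) => v ^+ i).
  move=> i j /eqP; rewrite (eq_prim_root_expr prim_v) !modn_small //.
  by move/eqP/val_inj.
rewrite -[RHS]card_ord -(card_imset _ vinj); apply: eq_card => x.
rewrite inE; apply/eqP/imsetP => [/(prim_rootP prim_v)[i ->]|[i _ ->]].
  by exists i.
by rewrite exprAC (prim_expr_order prim_v) expr1n.
Qed.

Lemma card_class i : #|[set x | in_class i x]| = (2 * n)%N.
Proof.
have wi0 : w ^+ i != 0 by rewrite expf_neq0 ?w_neq0.
rewrite -card_unity_roots -[RHS](card_imset _ (mulfI wi0)).
apply: eq_card => x; rewrite inE /in_class [(2 * n * i)%N]mulnC [w ^+ _]exprM.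
apply/eqP/imsetP => [xw|[y]]; last first.
  by rewrite inE => /eqP y1 ->; rewrite exprMn y1 mulr1.
exists (x / w ^+ i); last by rewrite mulrC divfK.
by rewrite inE exprMn exprVn xw divff // expf_neq0.
Qed.

Definition psum d i : F := \sum_(j < i) d j.

Lemma psumS d i : psum d i.+1 = psum d i + d i.
Proof. by rewrite /psum big_ord_recr. Qed.

(** The state of the greedy construction after [j] choices. *)
Definition walk d j :=
  (forall i, (i < j)%N -> in_class i (d i)) /\
  (forall a b, (a < b)%N -> (b <= j)%N -> psum d a != psum d b).

(** The walk stops at [k.-1] because the partial sum at [k] must return to the one at [0]. *)
Definition starter d :=
  [/\ walk d k.-1, in_class k.-1 (d k.-1) & psum d k = 0].

(** The ratios [d a / d' a] and [d b / d' b] differ even up to sign; cross-multiplying and squaring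
    removes the division and the sign. *)
Definition unlike d d' j :=
  forall a b, (a < b)%N -> (b < j)%N -> (d a * d' b) ^+ 2 != (d b * d' a) ^+ 2.

Definition extend d j (x : F) i := if i == j then x else d i.

Lemma extend_lt d j x i : (i < j)%N -> extend d j x i = d i.
Proof. by rewrite /extend ltn_neqAle => /andP[/negbTE->]. Qed.

Lemma extend_eq d j x : extend d j x j = x.
Proof. by rewrite /extend eqxx. Qed.

Lemma psum_extend d j x i : (i <= j)%N -> psum (extend d j x) i = psum d i.
Proof.
move=> ij; apply: eq_bigr => a _; rewrite extend_lt //.
exact: leq_trans ij.
Qed.

Lemma walk_extend d j x : walk d j -> in_class j x ->
  (forall a, (a <= j)%N -> psum d a != psum d j + x) ->
  walk (extend d j x) j.+1.
Proof.
case=> cl inj xj xa; split=> [i|a b ab].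
  rewrite ltnS leq_eqVlt => /predU1P[->|ij]; first by rewrite extend_eq.
  by rewrite extend_lt // cl.
rewrite leq_eqVlt => /predU1P[bE|]; last first.
  rewrite ltnS => bj; rewrite !psum_extend ?inj //.
  exact: leq_trans (ltnW ab) bj.
by move: ab; rewrite bE ltnS => aj; rewrite psumS !psum_extend // extend_eq xa.
Qed.

Lemma unlike_extend d d' j x : unlike d d' j ->
  (forall a, (a < j)%N -> (d a * d' j) ^+ 2 != (x * d' a) ^+ 2) ->
  unlike (extend d j x) d' j.+1.
Proof.
move=> un xa a b ab; rewrite ltnS leq_eqVlt => /predU1P[bE|bj].
  by move: ab; rewrite bE => aj; rewrite extend_eq extend_lt // xa.
by rewrite !extend_lt ?un // (ltn_trans ab).
Qed.

(* The values of [x] for which [extend d j x] may fail to be a walk, or to be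
   unlike one of [D 0 .. D M.-1]. *)
Definition bad_sums d j := [seq psum d a - psum d j | a <- iota 0 j.+1].
Definition bad_ratios d D M i j :=
  [seq d a * D s i / D s a | a <- iota 0 j, s <- iota 0 M] ++
  [seq - (d a * D s i / D s a) | a <- iota 0 j, s <- iota 0 M].

Lemma size_bad_sums d j : size (bad_sums d j) = j.+1.
Proof. by rewrite size_map size_iota. Qed.

Lemma size_bad_ratios d D M i j : size (bad_ratios d D M i j) = (2 * j * M)%N.
Proof. by rewrite size_cat !size_allpairs !size_iota; ring. Qed.

Lemma notin_bad_sums d j x : x \notin bad_sums d j ->
  forall a, (a <= j)%N -> psum d a != psum d j + x.
Proof.
move=> xb a aj; apply: contra xb => /eqP aE; apply/mapP; exists a.
  by rewrite mem_iota.
by rewrite aE; ring.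
Qed.

Lemma notin_bad_ratios d D M i j x : x \notin bad_ratios d D M i j ->
  forall s a, (s < M)%N -> (a < j)%N -> D s a != 0 ->
  (d a * D s i) ^+ 2 != (x * D s a) ^+ 2.
Proof.
rewrite mem_cat negb_or => /andP[xp xm] s a sM aj D0.
rewrite eqf_sqr negb_or; apply/andP; split; [apply: contra xp|apply: contra xm];
  move=> /eqP e; apply/allpairsP; exists (a, s); rewrite /= !mem_iota;
  split=> //; rewrite e; first by rewrite mulfK.
by rewrite mulNr opprK mulfK.
Qed.

Lemma exists_notin (A : {set F}) (s : seq F) :
  (size s < #|A|)%N -> exists2 x, x \in A & x \notin s.
Proof.
move=> sA; have /subsetPn[x xA xs] : ~~ (A \subset s).
  by apply: contraL sA => /subset_leq_card; rewrite -leqNgt => /leq_trans;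
     apply; exact: card_size.
by exists x.
Qed.

(** Each class has [2 * n] elements, while step [j] has at most [j.+1 + 2 * j * M] bad values, fewer
    than [2 * n] because [k * M.+1 <= n]. *)
Lemma exists_walk D M j : (k ^ 3 * M.+1 <= n)%N -> (j <= k.-2)%N ->
  (forall s, (s < M)%N -> starter (D s)) ->
  exists d, walk d j /\ forall s, (s < M)%N -> unlike d (D s) j.
Proof.
move=> nM jk stD; elim: j jk => [|j IH] jk.
  exists (fun=> 0); split; last by move=> s _ a b.
  by split=> // a b ab; rewrite leqn0 => /eqP b0; rewrite b0 in ab.
have [d [wd ud]] := IH (ltnW jk).
have [|x] := @exists_notin [set x | in_class j x]
    (bad_sums d j ++ bad_ratios d D M j j).
  rewrite card_class size_cat size_bad_sums size_bad_ratios.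
  have kM : (k * M.+1 <= n)%N.
    apply: leq_trans nM; rewrite leq_mul2r orbC -{1}[k]expn1 leq_exp2l //.
    by apply: ltn_trans k_gt2.
  have jM : (j * M <= k * M)%N by rewrite leq_mul2r; lia.
  lia.
rewrite inE mem_cat negb_or => xj /andP[xs xr].
exists (extend d j x); split.
  by apply: walk_extend => //; apply: notin_bad_sums.
move=> s sM; apply: unlike_extend; first exact: ud.
move=> a aj; apply: (notin_bad_ratios xr) => //.
have [[cl _] _ _] := stD s sM; apply: in_class_neq0 (cl _ _); lia.
Qed.

Lemma card_last_step_gt M N : (k ^ 3 * M.+1 <= n)%N ->
  ((#|F| * N)%:Z - ((2 * n) ^ 2)%:Z) ^+ 2 <= (#|F| ^ 3)%:Z ->
  ((4 * k - 6) * M + k.-1 < N)%N.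
Proof.
move=> nM var; rewrite ltnNge; apply/negP => NB; move: var; apply/negP.
rewrite -ltNge.
have := @last_step_inequality k n M N #|F|; rewrite cardF => H.
rewrite [(_ * N)%N%:Z]PoszM -[(_ ^ 2)%N%:Z]natz natrX natz.
rewrite -[(_ ^ 3)%N%:Z]natz natrX natz [(2 * n)%N%:Z]PoszM.
apply: H => //; lia.
Qed.

Lemma exists_starter D M : (k ^ 3 * M.+1 <= n)%N ->
  (forall s, (s < M)%N -> starter (D s)) ->
  exists d, starter d /\ forall s, (s < M)%N -> unlike d (D s) k.
Proof.
move=> nM stD; have [d [wd ud]] := exists_walk nM (leqnn _) stD.
set j := k.-2 in wd ud.
have kE : k = j.+2 by rewrite /j; case: k k_gt2 => [|[]].
have j0 : (0 < j)%N by move: k_gt2; rewrite kE.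
(* The last two entries must sum to [t] for the walk to close up. It is nonzero because the partial
   sums at [0] and [j] differ. *)
set t := - psum d j.
have t0 : t != 0.
  case: wd => _ /(_ 0%N j j0 (leqnn _)).
  by rewrite oppr_eq0 eq_sym /psum big_ord0.
have D0 s a : (s < M)%N -> (a < k)%N -> D s a != 0.
  move=> sM; have [[cl _] clk _] := stD s sM.
  rewrite {1}kE ltnS leq_eqVlt => /predU1P[->|aj].
    by apply: in_class_neq0 (_ : in_class k.-1 _); rewrite kE in clk *.
  by apply: in_class_neq0 (cl _ _); rewrite kE.
(* The lists below exclude, in turn: a repeated partial sum; a coincidence of entry [j] with an
   earlier one; the same for entry [j.+1], which is [t - x]; and a coincidence between entries [j]
   and [j.+1], that is [x * r s = t - x] or [x * r s = - (t - x)]. Their total length is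
   [(4 * j + 2) * M + j.+1]. *)
pose r s := D s j.+1 / D s j.
have [|x] := @exists_notin [set x | in_class j x && in_class j.+1 (t - x)]
    (bad_sums d j ++ bad_ratios d D M j j ++
     [seq t - y | y <- bad_ratios d D M j.+1 j] ++
     [seq t / (1 + r s) | s <- iota 0 M] ++ [seq t / (1 - r s) | s <- iota 0 M]).
  rewrite size_cat size_bad_sums size_cat size_bad_ratios size_cat size_map.
  rewrite size_bad_ratios size_cat !size_map !size_iota.
  set N := #|_|.
  have := @card_last_step_gt M N nM.
  have -> : (4 * k - 6 = 4 * j + 2)%N by rewrite kE; lia.
  rewrite kE /= => H.
  have {}H : (((4 * j + 2) * M + j.+1) < N)%N.
    apply: H; apply: (@card_sum_representations _ (2 * n) _ _ (w ^+ j) (w ^+ j.+1) t).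
    - lia.
    - by rewrite expf_neq0 ?w_neq0.
    - by rewrite expf_neq0 ?w_neq0.
    - exact: t0.
    - by rewrite card_unity_roots.
    - by apply: eq_card => x; rewrite !inE /in_class -!exprM ![(_ * (2 * n))%N]mulnC.
  by apply: leq_ltn_trans H; nia.
rewrite inE mem_cat negb_or => /andP[xj xj1] /andP[xs].
rewrite mem_cat negb_or => /andP[xr]; rewrite mem_cat negb_or => /andP[yr].
rewrite mem_cat negb_or => /andP[rp rm].
pose d1 := extend d j x.
have wd1 : walk d1 j.+1.
  by apply: walk_extend => //; apply: notin_bad_sums.
have ud1 s : (s < M)%N -> unlike d1 (D s) j.+1.
  move=> sM; apply: unlike_extend; first exact: ud.
  move=> a aj; apply: (notin_bad_ratios xr) => //.
  by apply: D0; rewrite // kE ltnS leqW // ltnW.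
pose d2 := extend d1 j.+1 (t - x).
exists d2; split.
  rewrite /starter kE /=; split; last first.
  - rewrite psumS psum_extend // /d2 extend_eq psumS psum_extend // /d1.
    by rewrite extend_eq /t; ring.
  - by rewrite /d2 extend_eq.
  case: wd1 => cl inj; split=> [i ij|a b ab bj].
    by rewrite /d2 extend_lt // cl.
  have aj := leq_trans (ltnW ab) bj.
  by rewrite (psum_extend _ _ aj) (psum_extend _ _ bj) inj.
move=> s sM; rewrite kE; apply: unlike_extend; first exact: ud1.
have Dj0 : D s j != 0 by apply: D0; rewrite // kE.
move=> a; rewrite ltnS leq_eqVlt => /predU1P[->|aj]; last first.
  rewrite /d1 extend_lt //.
  apply: (@notin_bad_ratios d D M j.+1 j) => //; last first.
    by apply: D0; rewrite // kE ltnS leqW // ltnW.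
  apply: contra yr => yb; apply/mapP; exists (t - x) => //; ring.
rewrite /d1 extend_eq eqf_sqr negb_or; apply/andP; split.
  apply: contra rp => /eqP e; apply/mapP; exists s; first by rewrite mem_iota.
  have xE : x * (1 + r s) = t.
    by rewrite /r mulrDr mulr1 mulrA e mulfK //; ring.
  by rewrite -{1}xE mulfK //; apply: contra t0 => /eqP r0; rewrite -xE r0 mulr0.
apply: contra rm => /eqP e; apply/mapP; exists s; first by rewrite mem_iota.
have xE : x * (1 - r s) = t.
  by rewrite /r mulrBr mulr1 mulrA e mulNr mulfK //; ring.
by rewrite -{1}xE mulfK //; apply: contra t0 => /eqP r0; rewrite -xE r0 mulr0.
Qed.

Lemma exists_starters M : (k ^ 3 * M <= n)%N ->
  exists D, (forall s, (s < M)%N -> starter (D s)) /\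
    forall s s', (s' < s)%N -> (s < M)%N -> unlike (D s) (D s') k.
Proof.
elim: M => [|M IH] nM; first by exists (fun _ _ => 0).
have [|D [stD unD]] := IH.
  by apply: leq_trans nM; rewrite leq_mul2l leqnSn orbT.
have [d [std und]] := exists_starter nM stD.
exists (fun s => if s == M then d else D s); split=> [s|s s' s's].
  rewrite ltnS leq_eqVlt => /predU1P[->|sM]; first by rewrite eqxx.
  by rewrite ltn_eqF //; apply: stD.
rewrite ltnS leq_eqVlt => /predU1P[sE|sM].
  by rewrite sE eqxx; rewrite sE in s's; rewrite ltn_eqF //; apply: und.
by rewrite !ltn_eqF ?(ltn_trans s's) //; apply: unD.
Qed.

End Starters.

(** * Edges of cycles given by closed sequences *)

Lemma cycle_edges_mkseq (T : finType) (g : nat -> T) k :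
  uniq (mkseq g k) -> g k = g 0 ->
  cycle_edges (mkseq g k) = [set [set g i; g i.+1] | i : 'I_k].
Proof.
move=> ug gk; have nextE i : i < k -> next (mkseq g k) (g i) = g i.+1.
  case: k ug gk => // k ug gk ik.
  have gi : g i \in mkseq g k.+1 by apply: map_f; rewrite mem_iota.
  have idx : index (g i) (mkseq g k.+1) = i.
    by rewrite -{1}(nth_mkseq (g 0) g ik) index_uniq ?size_mkseq.
  rewrite next_nth gi idx.
  have -> : mkseq g k.+1 = g 0 :: [seq g j | j <- iota 1 k] by [].
  (* At the last vertex [nth] runs past the end and returns its default [g 0], which is [g k.+1]; so
     the wrap-around edge has the same form as the others. *)
  move: ik; rewrite ltnS leq_eqVlt => /predU1P[->|ik].
    by rewrite nth_default ?size_map ?size_iota // gk.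
  by rewrite (nth_map 0) ?size_iota // nth_iota.
apply/setP => e; apply/imsetP/imsetP => -[].
  move=> x /mapP[i]; rewrite mem_iota => /= ik -> ->.
  by exists (Ordinal ik); rewrite ?nextE.
move=> i _ ->; exists (g i); last by rewrite nextE.
by apply: map_f; rewrite mem_iota /=.
Qed.

Lemma eq_set2 (T : finType) (x y x' y' : T) : [set x; y] = [set x'; y'] ->
  (x = x' /\ y = y') \/ (x = y' /\ y = x').
Proof.
move=> E; have : x \in [set x'; y'] by rewrite -E set21.
have : y \in [set x'; y'] by rewrite -E set22.
have : x' \in [set x; y] by rewrite E set21.
have : y' \in [set x; y] by rewrite E set22.
rewrite !inE => /orP[] /eqP ? /orP[] /eqP ? /orP[] /eqP ? /orP[] /eqP ?;
  subst; auto.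
Qed.

(** * The cycle system developed from a starter, and orthogonality *)

Section Systems.

Local Open Scope ring_scope.
Variables (F : finFieldType) (k n : nat) (w : F).
Hypothesis k_gt2 : (2 < k)%N.
Hypothesis n_odd : odd n.
Hypothesis cardF : #|F| = (2 * k * n + 1)%N.
Hypothesis prim_w : (2 * k * n).-primitive_root w.
Variables (T : finType) (f : F -> T) (g : T -> F).
Hypotheses (fK : cancel f g) (gK : cancel g f).
Implicit Types (d : nat -> F) (p : F * F).

Let n_gt0 : (0 < n)%N. Proof. exact: odd_gt0. Qed.

Lemma expr_opp_odd (x : F) : (- x) ^+ n = - x ^+ n.
Proof. by rewrite exprNn -signr_odd n_odd expr1 mulN1r. Qed.

(** Otherwise [w ^+ (k * n)], whose square is [1], would be [1], against the order of [w]. *)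
Lemma oppr1_neq1 : - 1 != 1 :> F.
Proof.
apply/eqP => N1.
have : (w ^+ (k * n)) ^+ 2 == 1.
  by rewrite -exprM mulnC mulnA (prim_expr_order prim_w).
rewrite sqrf_eq1 N1 orbb -(prim_order_dvd prim_w) => /dvdn_leq.
have := k_gt2; nia.
Qed.

Lemma starter_in_class d i : starter k n w d -> (i < k)%N -> in_class n w i (d i).
Proof.
case=> -[cl _] clk _ ik.
have : (i <= k.-1)%N by rewrite -ltnS prednK // (ltn_trans _ k_gt2).
by rewrite leq_eqVlt => /predU1P[->|/cl].
Qed.

Lemma starter_neq0 d i : starter k n w d -> (i < k)%N -> d i != 0.
Proof.
move=> sd ik.
exact: (in_class_neq0 n_gt0 prim_w (starter_in_class sd ik)).
Qed.

Lemma class_inj i j (x y : F) : (i < k)%N -> (j < k)%N ->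
  in_class n w i x -> in_class n w j y -> x ^+ (2 * n) = y ^+ (2 * n) -> i = j.
Proof.
move=> ik jk /eqP xi /eqP yj xy; move: xy; rewrite xi yj => /eqP.
rewrite (eq_prim_root_expr prim_w) !modn_small; last 2 first.
- by rewrite [(2 * k * n)%N]mulnAC ltn_pmul2l // muln_gt0 n_gt0.
- by rewrite [(2 * k * n)%N]mulnAC ltn_pmul2l // muln_gt0 n_gt0.
by rewrite eqn_pmul2l ?muln_gt0 ?n_gt0 // => /eqP.
Qed.

(** [p] stands for the affine map [x |-> p.1 * x + p.2], and [f] names field elements as
    vertices. *)
Definition vertex d p i := f (p.1 * psum d i + p.2).
Definition block d p := cycle_edges (mkseq (vertex d p) k).
Definition system d := [set block d p | p in [set p : F * F | p.1 ^+ n == 1]].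

Lemma root_neq0 (a : F) : a ^+ n = 1 -> a != 0.
Proof.
by apply: contra_eq_neq => ->; rewrite expr0n gtn_eqF // eq_sym oner_eq0.
Qed.

Lemma uniq_vertices d p : starter k n w d -> p.1 ^+ n = 1 ->
  uniq (mkseq (vertex d p) k).
Proof.
case=> -[_ inj] _ _ /root_neq0 p0; apply/mkseq_uniqP => i j.
rewrite !inE => ik jk /(can_inj fK)/addIr/(mulfI p0) ij.
have H a b : (a < b)%N -> (b < k)%N -> psum d a != psum d b.
  by move=> ab bk; apply: inj; rewrite // -ltnS prednK // (leq_ltn_trans _ bk).
by case: (ltngtP i j) => // lt_ij; [have := H _ _ lt_ij jk|have := H _ _ lt_ij ik];
  rewrite ij eqxx.
Qed.

Lemma blockP d p e : starter k n w d -> p.1 ^+ n = 1 ->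
  reflect (exists2 i, (i < k)%N & e = [set vertex d p i; vertex d p i.+1])
          (e \in block d p).
Proof.
move=> sd p1; have ud := uniq_vertices sd p1; case: sd => _ _ s0.
rewrite /block cycle_edges_mkseq //; last first.
  by rewrite /vertex s0 /psum big_ord0.
apply: (iffP imsetP) => [[i _ ->]|[i ik ->]]; first by exists i.
by exists (Ordinal ik).
Qed.

Lemma is_kcycle_block d p : starter k n w d -> p.1 ^+ n = 1 ->
  is_kcycle k (block d p).
Proof.
move=> sd p1; split=> //; exists (mkseq (vertex d p) k).
by rewrite size_mkseq uniq_vertices.
Qed.

(** An edge determines the difference of its ends up to sign. The [2 * n]-th power forgets the sign
    and the multiplier, so it reveals the class, hence the index. *)
Lemma common_edge d d' p p' i i' : starter k n w d -> starter k n w d' ->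
  p.1 ^+ n = 1 -> p'.1 ^+ n = 1 -> (i < k)%N -> (i' < k)%N ->
  [set vertex d p i; vertex d p i.+1] = [set vertex d' p' i'; vertex d' p' i'.+1] ->
  i = i' /\
  ((p.1 * d i = p'.1 * d' i' /\ p.1 * psum d i + p.2 = p'.1 * psum d' i' + p'.2)
   \/ p.1 * d i = - (p'.1 * d' i')).
Proof.
move=> sd sd' p1 p1' ik ik' /eq_set2 E.
have {}E : (p.1 * d i = p'.1 * d' i' /\
     p.1 * psum d i + p.2 = p'.1 * psum d' i' + p'.2)
   \/ p.1 * d i = - (p'.1 * d' i').
  have dE (c : nat -> F) (r : F * F) j : r.1 * c j =
      (r.1 * psum c j.+1 + r.2) - (r.1 * psum c j + r.2).
    by rewrite psumS; ring.
  rewrite (dE d p i) (dE d' p' i');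
  case: E => -[/(can_inj fK) -> /(can_inj fK) ->]; first by left.
  by right; rewrite opprB.
split=> //; apply: (class_inj ik ik' (starter_in_class sd ik)).
  exact: starter_in_class sd' ik'.
have q1 (a x : F) : a ^+ n = 1 -> x ^+ (2 * n) = (a * x) ^+ (2 * n).
  by move=> a1; rewrite exprMn [a ^+ _]exprM exprAC a1 expr1n mul1r.
rewrite (q1 p.1) // (q1 p'.1 (d' i')) //.
by case: E => [[-> _]//|->]; rewrite exprM sqrrN -exprM.
Qed.

(** If the edge were traversed in opposite directions, the multipliers would be opposite, but for
    odd [n] only one of [a] and [- a] is an [n]-th root of unity. *)
Lemma block_edge_inj d p p' e : starter k n w d ->
  p.1 ^+ n = 1 -> p'.1 ^+ n = 1 -> e \in block d p -> e \in block d p' -> p = p'.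
Proof.
move=> sd p1 p1' /(blockP _ sd p1)[i ik ->] /(blockP _ sd p1')[i' ik'].
case/common_edge => // ii'; rewrite -{i' ik'}ii'.
have d0 := starter_neq0 sd ik.
case=> [[/(mulIf d0) pp']|].
  rewrite pp' => /addrI pp2.
  by rewrite [p]surjective_pairing [p']surjective_pairing pp' pp2.
rewrite -mulNr => /(mulIf d0) pN; move: p1; rewrite pN expr_opp_odd p1' => /eqP.
by rewrite (negbTE oppr1_neq1).
Qed.

(** The class of [y - x] selects the index [i], and [(y - x) / d i] is then a [2 * n]-th root of
    unity. *)
Lemma edge_covered d (x y : F) : starter k n w d -> x != y ->
  exists2 p : F * F, p.1 ^+ n = 1 & [set f x; f y] \in block d p.
Proof.
move=> sd xy; set u := y - x.
have u0 : u != 0 by rewrite subr_eq0 eq_sym.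
have uq : u ^+ (2 * k * n) = 1.
  by apply: (mulfI u0); rewrite -exprS mulr1 -[RHS]expf_card cardF addn1.
have [j uj] := prim_rootP prim_w uq.
have k0 : (0 < k)%N by apply: ltn_trans k_gt2.
pose i := (j %% k)%N; have ik : (i < k)%N by rewrite ltn_mod.
have d0 := starter_neq0 sd ik.
have ud : (u / d i) ^+ (2 * n) = 1.
  rewrite exprMn exprVn (eqP (starter_in_class sd ik)).
  rewrite (_ : u ^+ (2 * n) = w ^+ (2 * n * i)) ?divff ?expf_neq0 //.
    exact: w_neq0 prim_w.
  rewrite uj -exprM mulnC (divn_eq j k) mulnDr exprD.
  have -> : (2 * n * (j %/ k * k) = 2 * k * n * (j %/ k))%N by ring.
  by rewrite exprM (prim_expr_order prim_w) expr1n mul1r.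
(* The sign of the [n]-th power decides the direction of the edge; the translation is chosen so that
   vertex [i] is [x] in the first case and [y] in the second. *)
move: ud; rewrite mulnC exprM => /eqP; rewrite sqrf_eq1 => /orP[] /eqP a1.
  exists (u / d i, x - u / d i * psum d i) => //.
  apply/blockP => //; exists i => //; rewrite /vertex psumS /=.
  by congr [set f _; f _]; rewrite /u; field.
have a1' : (- (u / d i)) ^+ n = 1 by rewrite expr_opp_odd a1 opprK.
exists (- (u / d i), y + u / d i * psum d i) => //.
apply/blockP => //; exists i => //; rewrite /vertex psumS /= setUC.
by congr [set f _; f _]; rewrite /u; field.
Qed.

(** Edges [0] and [1] have different indices, hence differ. This excludes an empty block and, later,
    a block common to two orthogonal systems. *)
Lemma card_block d p : starter k n w d -> p.1 ^+ n = 1 -> (1 < #|block d p|)%N.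
Proof.
move=> sd p1.
have k1 : (1 < k)%N by apply: ltn_trans k_gt2.
have k0 : (0 < k)%N by apply: ltn_trans k1.
apply/card_gt1P.
exists [set vertex d p 0; vertex d p 1], [set vertex d p 1; vertex d p 2].
split.
- by apply/blockP => //; exists 0%N.
- by apply/blockP => //; exists 1%N.
by apply/eqP => /common_edge[] //.
Qed.

Lemma system_partition d : starter k n w d ->
  partition (system d) (complete_graph T).
Proof.
move=> sd; apply/and3P; split.
- rewrite eqEsubset; apply/andP; split; apply/subsetP => e.
    case/bigcupP => C /imsetP[p]; rewrite inE => /eqP p1 ->.
    move=> /(blockP _ sd p1)[i ik ->].
    rewrite inE cards2 (can_eq fK) psumS mulrDr -addrA.
    rewrite [_ * d i + _]addrC addrA -subr_eq0 opprD addNKr oppr_eq0 mulf_eq0.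
    by rewrite (negbTE (root_neq0 p1)) (negbTE (starter_neq0 sd ik)).
  rewrite inE => /cards2P[x [y [xy ->]]].
  have [|p p1] := @edge_covered d (g x) (g y) sd.
    by rewrite (can_eq gK).
  rewrite !gK => ep; apply/bigcupP; exists (block d p) => //.
  by apply/imsetP; exists p; rewrite ?inE ?p1.
- apply/trivIsetP => _ _ /imsetP[p + ->] /imsetP[p' + ->].
  rewrite !inE => /eqP p1 /eqP p1'; apply: contraR => /pred0Pn[e /= /andP[ep ep']].
  by rewrite (block_edge_inj sd p1 p1' ep ep').
apply/imsetP => -[p]; rewrite inE => /eqP p1 E.
by have := card_block sd p1; rewrite -E cards0.
Qed.

(** A shared edge has the same index [i] in both blocks and gives [p.1 * d i = p'.1 * d' i] up to
    sign. Eliminating the multipliers between two indices contradicts [unlike]. *)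
Lemma block_card_common d d' p p' : starter k n w d -> starter k n w d' ->
  unlike d d' k -> p.1 ^+ n = 1 -> p'.1 ^+ n = 1 ->
  (#|block d p :&: block d' p'| <= 1)%N.
Proof.
move=> sd sd' un p1 p1'; apply/card_le1_eqP => e1 e2.
rewrite !inE => /andP[/(blockP _ sd p1)[i ik ->] /(blockP _ sd' p1')[i' ik' E]].
case/andP=> /(blockP _ sd p1)[j jk ->] /(blockP _ sd' p1')[j' jk' E'].
have [] := common_edge sd sd' p1 p1' ik ik' E.
have [] := common_edge sd sd' p1 p1' jk jk' E'.
move=> <- Dj <- Di.
have sq (x y : F) P : (x = y /\ P) \/ x = - y -> x ^+ 2 = y ^+ 2.
  by case=> [[->]//|->]; rewrite sqrrN.
move: Di Dj => /sq Di /sq Dj.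
have H a b : (p.1 * d a) ^+ 2 = (p'.1 * d' a) ^+ 2 ->
    (p.1 * d b) ^+ 2 = (p'.1 * d' b) ^+ 2 ->
    (d a * d' b) ^+ 2 = (d b * d' a) ^+ 2.
  move=> Da Db; have pp : (p.1 * p'.1) ^+ 2 != 0.
    by rewrite expf_neq0 // mulf_neq0 // root_neq0.
  apply: (mulfI pp).
  transitivity ((p.1 * d a) ^+ 2 * (p'.1 * d' b) ^+ 2); first by ring.
  by rewrite Da -Db; ring.
by case: (ltngtP i j) => [ij|ij|-> //];
  [have := un _ _ ij jk; rewrite (H i j) // | have := un _ _ ij ik; rewrite (H j i) //];
  rewrite eqxx.
Qed.

End Systems.

(** * A generator of the multiplicative group, and the family on ['I_q] *)

Lemma exists_prim_root (F : finFieldType) :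
  exists w : F, #|F|.-1.-primitive_root%R w.
Proof.
have F1 : 0 < #|F|.-1 by rewrite -subn1 subn_gt0 finNzRing_gt1.
have /hasP[w _ prim_w] : has #|F|.-1.-primitive_root%R (enum [set~ (0 : F)%R]).
  apply: has_prim_root => //; first 1 last.
  - exact: enum_uniq.
  - by rewrite -cardE cardsC1.
  apply/allP => x; rewrite mem_enum !inE => x0; rewrite unity_rootE.
  apply/eqP/(mulfI x0); rewrite mulr1 -exprS prednK ?expf_card //.
  by apply: ltn_trans F1 _; rewrite prednK // (ltn_trans _ (finNzRing_gt1 F)).
by exists w.
Qed.

Theorem theorem4p1 (q k n : nat) (hq : q = 2 * k * n + 1)
    (hpp : prime_power q) (hk : 3 <= k) (hn : odd n) :
  exists F : {set {set {set {set 'I_q}}}},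
    [/\ forall S, S \in F -> kcycle_system k S,
        mutually_orthogonal F
      & n %/ k ^ 3 <= #|F|].
Proof.
have [p [e [pr_p e0 qE]]] := hpp.
have [K _ cardK] := pPrimePowerField pr_p e0.
have {}cardK : #|K| = q by rewrite cardK qE.
have cK : #|K| = 2 * k * n + 1 by rewrite cardK.
have [w] := exists_prim_root K; rewrite cK addn1 /= => prim_w.
pose f (x : K) : 'I_q := cast_ord cardK (enum_rank x).
pose g (i : 'I_q) : K := enum_val (cast_ord (esym cardK) i).
have fK : cancel f g by move=> x; rewrite /f /g cast_ordK enum_rankK.
have gK : cancel g f by move=> i; rewrite /f /g enum_valK cast_ordKV.
have n0 := odd_gt0 hn.
have [|D [stD unD]] := @exists_starters K k n w hk n0 cK prim_w (n %/ k ^ 3).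
  by rewrite mulnC leq_divM.
pose S (s : 'I_(n %/ k ^ 3)) := system k n f (D s).
have orthS s s' : s != s' -> orthogonal_systems (S s) (S s').
  move=> ss' _ _ /imsetP[a + ->] /imsetP[b + ->]; rewrite !inE => /eqP a1 /eqP b1.
  (* [unD] compares a starter only with earlier ones; the other order follows by commuting the
     intersection. *)
  move: ss'; rewrite neq_ltn => /orP[lt_s|lt_s]; last first.
    by apply: (block_card_common hk hn prim_w fK) => //; do ?exact: stD; apply: unD.
  rewrite setIC.
  by apply: (block_card_common hk hn prim_w fK) => //; do ?exact: stD; apply: unD.
(* Equal systems from different starters would share a block, which has at least two edges, against
   orthogonality; so the family has exactly [n %/ k ^ 3] members. *)
have injS : injective S.
  move=> s s' E; apply/eqP; apply: contraT => /orthS.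
  rewrite -E => /(_ (block k f (D s) (1, 0)%R) (block k f (D s) (1, 0)%R)).
  have b1 : block k f (D s) (1, 0)%R \in S s.
    by apply/imsetP; exists (1, 0)%R; rewrite ?inE ?expr1n.
  move=> /(_ b1 b1); rewrite setIid leqNgt (card_block hk hn prim_w fK) //.
  - exact: stD.
  - by rewrite expr1n.
exists [set S s | s : 'I_(n %/ k ^ 3)]; split.
- move=> _ /imsetP[s _ ->]; split.
    move=> _ /imsetP[a + ->]; rewrite inE => /eqP a1.
    by apply: (is_kcycle_block hk hn fK (stD _ _) a1).
  exact: (system_partition hk hn cK prim_w fK gK (stD _ _)).
- move=> _ _ /imsetP[s _ ->] /imsetP[s' _ ->] SS'; apply: orthS.
  by apply: contra_not_neq SS' => ->.
by rewrite card_imset // card_ord.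
Qed.
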